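(* Let $\mathcal{A}\subseteq E^\infty$ be an $F_{\sigma\delta}$ set or a $G_{\delta\sigma}$ set. Then there is an infinite-dimensional block subspace $X\subseteq E$ such that either (1) player II has a strategy in the game $A_X$ to play in $E^\infty\setminus\mathcal{A}$, or (2) player I has a strategy in the game $B_X$ to play in $\mathcal{A}$.
   Context: Fix a countable field $\mathfrak F$ and let $E$ be the countable-dimensional $\mathfrak F$-vector space with basis $(e_n)_{n\in\mathbb N}$. For non-zero $x=\sum a_ne_n\in E$, ${\rm supp}\,x=\{n: a_n\neq 0\}$. A finite or infinite sequence $(x_0,x_1,\dots)$ of non-zero vectors is a block sequence if $\max{\rm supp}\,x_n<\min{\rm supp}\,x_{n+1}$ for all $n$. A block subspace is the linear span of an infinite block sequence; throughout, ''subspace'' (letters $V,W,X,Y,Z$) means an infinite-dimensional block subspace of $E$. For a block subspace $X$ and $k\in\mathbb N$, $X[k]=\{x\in X\setminus\{0\}: k<\min{\rm supp}\,x\}$. $E$ carries the discrete topology and $E^\infty=E^{\mathbb N}$ the product topology (a Polish space). The game $A_V$ (for a block subspace $V$): II plays $n_0\in\mathbb N$; I plays a non-zero vector $x_0\in V[n_0]$ and a block subspace $Z_0\subseteq V$; II plays a non-zero $y_0\in Z_0$ and $n_1\in\mathbb N$; I plays $x_1\in V[n_1]$ and $Z_1\subseteq V$; II plays $y_1\in Z_1$ and $n_2$; and so on. The outcome is $(x_0,y_0,x_1,y_1,\dots)\in E^\infty$. The game $B_V$: II plays a block subspace $Z_0\subseteq V$; I plays a non-zero $x_0\in Z_0$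 and $n_0\in\mathbb N$; II plays a non-zero $y_0\in V[n_0]$ and a block subspace $Z_1\subseteq V$; I plays $x_1\in Z_1$ and $n_1$; II plays $y_1\in V[n_1]$ and $Z_2$; and so on. The outcome is $(x_0,y_0,x_1,y_1,\dots)$. A player has a strategy to play in a set $\mathcal{B}\subseteq E^\infty$ if he has a strategy such that every outcome of a run in which he follows it lies in $\mathcal B$. *)

(* Defs.v *)
From HB Require Import structures.
From mathcomp Require Import all_boot all_order all_algebra.
Set Implicit Arguments. Unset Strict Implicit. Unset Printing Implicit Defensive.
Import GRing.Theory.
Local Open Scope ring_scope.

Section Defs.
Variable F : fieldType.

(* E = countable-dimensional F-vector space with basis (e_n); a vector is its
   finite coefficient sequence, normalized (no trailing zero). *)
Definition vecE : Type := {s : seq F | last 1 s != 0}.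

Definition coeff (x : vecE) (i : nat) : F := nth 0 (val x) i.

Definition vnonzero (x : vecE) : Prop := exists i, coeff x i != 0.

(* min supp / max supp (meaningful for non-zero x) *)
Definition minsupp (x : vecE) : nat := find (fun a => a != 0) (val x).
Definition maxsupp (x : vecE) : nat := (size (val x)).-1.

Definition block_seq (b : nat -> vecE) : Prop :=
  forall k, vnonzero (b k) /\ (maxsupp (b k) < minsupp (b k.+1))%N.

Definition in_span (b : nat -> vecE) (x : vecE) : Prop :=
  exists (n : nat) (a : nat -> F),
    forall i, coeff x i = \sum_(k < n) a k * coeff (b k) i.

Definition block_subspace (X : vecE -> Prop) : Prop :=
  exists b : nat -> vecE, block_seq b /\ forall x, X x <-> in_span b x.

Definition subset_of (Z V : vecE -> Prop) : Prop := forall x, Z x -> V x.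

Definition tail_part (V : vecE -> Prop) (k : nat) (x : vecE) : Prop :=
  V x /\ vnonzero x /\ (k < minsupp x)%N.

(* Topology on E^infty = nat -> vecE: product of discrete topologies. *)
Definition cylinder_agree (x y : nat -> vecE) (N : nat) : Prop :=
  forall i, (i < N)%N -> y i = x i.

Definition is_open (U : (nat -> vecE) -> Prop) : Prop :=
  forall x, U x -> exists N, forall y, cylinder_agree x y N -> U y.

Definition is_closed (C : (nat -> vecE) -> Prop) : Prop :=
  is_open (fun x => ~ C x).

Definition F_sigma_delta (A : (nat -> vecE) -> Prop) : Prop :=
  exists C : nat -> nat -> (nat -> vecE) -> Prop,
    (forall m n, is_closed (C m n)) /\
    forall x, A x <-> (forall m, exists n, C m n x).

Definition G_delta_sigma (A : (nat -> vecE) -> Prop) : Prop :=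
  exists U : nat -> nat -> (nat -> vecE) -> Prop,
    (forall m n, is_open (U m n)) /\
    forall x, A x <-> (exists m, forall n, U m n x).

Definition interleave (xs ys : nat -> vecE) : nat -> vecE :=
  fun n => if odd n then ys n./2 else xs n./2.

(* ---- Game A_V ----
   A strategy for II maps the history of I's moves (x_0,Z_0),...,(x_{k-1},Z_{k-1})
   to II's next move (y_{k-1}, n_k); for the empty history only n_0 is used. *)
Definition histA (xs : nat -> vecE) (Zs : nat -> vecE -> Prop) (k : nat)
  : seq (vecE * (vecE -> Prop)) := [seq (xs j, Zs j) | j <- iota 0 k].

Definition I_legalA (V : vecE -> Prop) (x : vecE) (Z : vecE -> Prop) (n : nat)
  : Prop := tail_part V n x /\ block_subspace Z /\ subset_of Z V.

Definition II_wins_A (V : vecE -> Prop) (B : (nat -> vecE) -> Prop) : Prop :=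
  exists sigma : seq (vecE * (vecE -> Prop)) -> vecE * nat,
  forall (xs : nat -> vecE) (Zs : nat -> vecE -> Prop),
    let n := fun k => (sigma (histA xs Zs k)).2 in
    let y := fun k => (sigma (histA xs Zs k.+1)).1 in
    (forall k, (forall j, (j <= k)%N -> I_legalA V (xs j) (Zs j) (n j)) ->
               Zs k (y k) /\ vnonzero (y k)) /\
    ((forall k, I_legalA V (xs k) (Zs k) (n k)) -> B (interleave xs y)).

(* ---- Game B_V ----
   A strategy for I maps II's moves Z_0..Z_k and y_0..y_{k-1} to (x_k, n_k). *)
Definition II_legalZ (V : vecE -> Prop) (Z : vecE -> Prop) : Prop :=
  block_subspace Z /\ subset_of Z V.

Definition I_wins_B (V : vecE -> Prop) (B : (nat -> vecE) -> Prop) : Prop :=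
  exists tau : seq (vecE -> Prop) -> seq vecE -> vecE * nat,
  forall (ys : nat -> vecE) (Zs : nat -> vecE -> Prop),
    let x := fun k => (tau (mkseq Zs k.+1) (mkseq ys k)).1 in
    let n := fun k => (tau (mkseq Zs k.+1) (mkseq ys k)).2 in
    (forall k, (forall j, (j <= k)%N -> II_legalZ V (Zs j)) ->
               (forall j, (j < k)%N -> tail_part V (n j) (ys j)) ->
               Zs k (x k) /\ vnonzero (x k)) /\
    ((forall k, II_legalZ V (Zs k) /\ tail_part V (n k) (ys k)) ->
       B (interleave x ys)).

End Defs.

(* Main.v *)
Require Import Defs.
From HB Require Import structures.
From mathcomp Require Import all_boot all_order all_algebra.
From mathcomp Require Import boolp.
Set Implicit Arguments. Unset Strict Implicit. Unset Printing Implicit Defensive.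

(* In the auxiliary Kastanas game the players alternately play a non-zero vector
   in the opponent's last subspace together with a block subspace of it, II
   moving first (the vector of that first move is ignored).  Up to complementing
   the payoff it is a G_delta_sigma game on an arbitrary set of moves, hence
   determined by Davis' theorem.  A winning strategy in it becomes one in
   the harder game A_Y (respectively B_Y) on a smaller subspace Y: there are
   only countably many vectors, so a fusion argument yields Y that is almost
   contained in the subspaces answered by the strategy along enough fictional
   runs to simulate every run inside Y.  B reduces to A because it is A
   with the roles exchanged, after a dummy first vector. *)

(** * Sequences built from their prefixes, and least witnesses *)

Lemma run_exists T (f : seq T -> T) : exists x, forall n, x n = f (mkseq x n).
Proof.
pose l n := iter n (fun s => rcons s (f s)) [::].
exists (fun n => f (l n)) => n; congr f.
by elim: n => // n IHn; rewrite mkseqS -IHn.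
Qed.

Lemma take_mkseq T (x : nat -> T) m n : m <= n -> take m (mkseq x n) = mkseq x m.
Proof. by move=> le_mn; rewrite -map_take take_iota (minn_idPl le_mn). Qed.

Lemma eq_mkseq_leq T (x y : nat -> T) m n :
  m <= n -> mkseq x n = mkseq y n -> mkseq x m = mkseq y m.
Proof. by move=> le_mn exy; rewrite -!(take_mkseq _ le_mn) exy. Qed.

Lemma eq_mkseq_nth T (x y : nat -> T) n k :
  mkseq x n = mkseq y n -> k < n -> x k = y k.
Proof. by move=> exy lt_kn; rewrite -(nth_mkseq (x 0) x lt_kn) exy nth_mkseq. Qed.

Lemma classical_ex_min (P : nat -> Prop) :
  (exists n, P n) -> exists n, P n /\ forall m, m < n -> ~ P m.
Proof.
move=> [n Pn]; have exP : exists n, `[<P n>] by exists n; apply/asboolP.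
case: (ex_minnP exP) => m /asboolP Pm min_m; exists m; split=> // k lt_km Pk.
by have := min_m k (asboolT Pk); rewrite leqNgt lt_km.
Qed.

(** * Determinacy of G_delta_sigma games *)

Section Determinacy.
Variables (M : Type) (m0 : M).

Definition extends (x : nat -> M) (p : seq M) := mkseq x (size p) = p.

Definition cyl_open (O : (nat -> M) -> Prop) :=
  forall x, O x -> exists n, forall y, mkseq y n = mkseq x n -> O y.

Definition forced (O : (nat -> M) -> Prop) (p : seq M) :=
  forall y, extends y p -> O y.

Lemma extends_mkseq x y n : extends y (mkseq x n) <-> mkseq y n = mkseq x n.
Proof. by rewrite /extends size_mkseq. Qed.

Lemma openP O x : cyl_open O -> O x ->
  exists n, forall k, n <= k -> forced O (mkseq x k).
Proof.
move=> openO /openO[n On]; exists n => k le_nk y /extends_mkseq eyx.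
exact/On/(eq_mkseq_leq le_nk).
Qed.

Definition follows (turn : nat -> bool) (sigma : seq M -> M) n x :=
  forall k, n <= k -> turn k -> x k = sigma (mkseq x k).

Variable turn : nat -> bool.

(** The winner moves where [turn] holds; [sigma] is consulted only from position [p] on. *)
Definition wins (A : (nat -> M) -> Prop) p :=
  exists sigma, forall x, extends x p -> follows turn sigma (size p) x -> A x.

Lemma wins_forced A p : forced A p -> wins A p.
Proof. by move=> Ap; exists (fun _ => m0) => x /Ap. Qed.

Lemma extends_rcons x p m : extends x (rcons p m) <-> extends x p /\ x (size p) = m.
Proof.
rewrite /extends size_rcons mkseqS; split=> [/rcons_inj[]|[-> ->]] //.
Qed.

Lemma wins_step A p m : turn (size p) -> wins A (rcons p m) -> wins A p.
Proof.
move=> tp [sigma win].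
exists (fun s => if size s == size p then m else sigma s) => x ext fol.
apply: win => [|k].
  by apply/extends_rcons; split=> //; rewrite fol // size_mkseq eqxx.
rewrite size_rcons => lt_pk tk; rewrite fol ?(ltnW lt_pk) // size_mkseq.
by rewrite gtn_eqF.
Qed.

(** Otherwise winning strategies for all [m] glue together, the move at index [size p] selecting the
    one to consult. *)
Lemma not_wins_step A p : ~~ turn (size p) -> ~ wins A p ->
  exists m, ~ wins A (rcons p m).
Proof.
move=> tp nw; apply: contrapT => /forallNP nex; apply: nw.
have /choice[sigma win] : forall m, wins A (rcons p m) by move=> m; exact: contrapT.
exists (fun s => sigma (nth m0 s (size p)) s) => x ext fol.
apply: (win (x (size p))) => [|k]; first exact/extends_rcons.
by rewrite size_rcons => lt_pk tk; rewrite fol ?(ltnW lt_pk) // nth_mkseq.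
Qed.

(** * Open approximation of a countable intersection of open sets *)

Section Approximation.
Variables (A : (nat -> M) -> Prop) (U : nat -> (nat -> M) -> Prop).
Hypothesis openU : forall n, cyl_open (U n).
Hypothesis subA : forall x, (forall n, U n x) -> A x.

(** [covers] lists the demands on [O] in [open_approximation], and [good] positions are those where
    they can be met. A run escapes when it is first committed to [U n] at a position that is not
    good. *)
Let covers p O := [/\ cyl_open O,
  forall x, extends x p -> (forall n, U n x) -> O x &
  ~ wins (fun x => A x \/ O x) p].
Let good p := exists O, covers p O.

Let enters n (p : seq M) k x := [/\ size p < k, forced (U n) (mkseq x k) &
  forall j, size p < j < k -> ~ forced (U n) (mkseq x j)].

Let escapes n (p : seq M) x := exists2 k, enters n p k x & ~ good (mkseq x k).

Let enters_eq n p k x y : mkseq y k = mkseq x k -> enters n p k x -> enters n p k y.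
Proof.
move=> eyx [lt_pk Uk min_k]; split=> //; first by rewrite eyx.
move=> j /andP[lt_pj lt_jk]; rewrite (eq_mkseq_leq (ltnW lt_jk) eyx).
by apply: min_k; rewrite lt_pj.
Qed.

Let enters_inj n p j k x : enters n p j x -> enters n p k x -> j = k.
Proof.
move=> [lt_pj Uj min_j] [lt_pk Uk min_k]; case: (ltngtP j k) => // lt.
  by case: (min_k j) => //; rewrite lt_pj.
by case: (min_j k) => //; rewrite lt_pk.
Qed.

Let enters_ex n p x : U n x -> exists k, enters n p k x.
Proof.
move=> /(openP (@openU n))[N UN].
have [|k [[lt_pk Uk] min_k]] :=
    @classical_ex_min (fun k => size p < k /\ forced (U n) (mkseq x k)).
  by exists (maxn N (size p).+1); split; [exact: leq_maxr|apply/UN/leq_maxl].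
by exists k; split=> // j /andP[lt_pj lt_jk] Uj; exact: (min_k j).
Qed.

(** If this could not be forced, the open sets chosen at the good entry positions would glue to one
    making [p] good. *)
Let wins_escapes n p : ~ good p -> wins (fun x => A x \/ escapes n p x) p.
Proof.
move=> bad_p; apply: contrapT => nw; apply: bad_p.
have [G Gspec] : {G | forall q, good q -> covers q (G q)}.
  have /choice[G ?] : forall q, exists O, good q -> covers q O; last by exists G.
  move=> q; have [[O cO]|bad] := pselect (good q); first by exists O.
  by exists (fun _ => True).
(* A bad entry position contributes its whole cylinder, a good one only the part inside its chosen
   open set. *)
pose O x := exists2 k, enters n p k x & good (mkseq x k) -> G (mkseq x k) x.
exists O; split.
- move=> x [k ek Gk]; have [gk|bk] := pselect (good (mkseq x k)).
    have [openG _ _] := Gspec _ gk; have [N GN] := openG _ (Gk gk).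
    exists (maxn k N) => y eyx; have eyxk := eq_mkseq_leq (leq_maxl k N) eyx.
    exists k; first exact: enters_eq ek.
    by rewrite eyxk => _; apply/GN/(eq_mkseq_leq _ eyx)/leq_maxr.
  by exists k => y eyx; exists k; [exact: enters_eq ek|rewrite eyx].
- move=> x ext Ux; have [k ek] := enters_ex p (Ux n); exists k => // gk.
  by have [_ + _] := Gspec _ gk; apply=> //; apply/extends_mkseq.
move=> [tau win]; apply: nw; exists tau => x ext fol.
have [|[k ek Gk]] := win x ext fol; [by left|right; exists k => // gk].
(* At a good entry position, continuing [tau] would win [A] enlarged by the open set chosen there,
   since all runs through that position enter at the same stage [k]. *)
have [_ _ []] := Gspec _ gk; exists tau => y /extends_mkseq eyx.
have [lt_pk _ _] := ek.
rewrite size_mkseq => foly; have [||Ay|[j ej Gj]] := win y; last 1 first.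
- have ejk := enters_inj ej (enters_eq eyx ek); subst j.
  by right; rewrite -eyx; apply: Gj; rewrite eyx.
- by rewrite /extends (eq_mkseq_leq (ltnW lt_pk) eyx).
- move=> j le_pj tj; have [/foly->//|lt_jk] := leqP k j.
  rewrite (eq_mkseq_nth eyx lt_jk) fol //.
  by rewrite (eq_mkseq_leq (ltnW lt_jk) eyx).
by left.
Qed.

(* If no such open set exists, the player wins by successively playing the
   strategies of [wins_escapes]: a run either settles in [A] at a finite stage
   or enters every [U n]. *)
Lemma open_approximation p : ~ wins A p ->
  exists O, [/\ cyl_open O, forall x, extends x p -> (forall n, U n x) -> O x &
    ~ wins (fun x => A x \/ O x) p].
Proof.
move=> nw; apply: contrapT => bad_p; apply: nw.
have [sig sigP] : {sig : nat -> seq M -> seq M -> M |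
    forall n q, ~ good q -> forall x, extends x q ->
      follows turn (sig n q) (size q) x -> A x \/ escapes n q x}.
  have /choice[sig P] : forall nq, exists sg : seq M -> M, ~ good nq.2 ->
      forall x, extends x nq.2 ->
      follows turn sg (size nq.2) x -> A x \/ escapes nq.1 nq.2 x.
    move=> [n q] /=; have [g|bad] := pselect (good q).
      by exists (fun _ => m0).
    by have [sg] := wins_escapes n bad; exists sg.
  by exists (fun n q => sig (n, q)) => n q; exact: (P (n, q)).
(* A state holds the index of the open set to enter next, the bad position where the current
   strategy started, and the current position. Entry at a bad position starts the next strategy. *)
pose switch n q := `[< forced (U n) q /\ ~ good q >].
pose step (st : nat * seq M * seq M) m :=
  let: (n, q, pos) := st in let pos' := rcons pos m in
  if switch n pos' then (n.+1, pos', pos') else (n, q, pos').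
pose state s := foldl step (0, p, p) (drop (size p) s).
exists (fun s => sig (state s).1.1 (state s).1.2 s) => x ext fol.
pose st k := (state (mkseq x k)).1.
have st0 : st (size p) = (0, p) by rewrite /st ext /state drop_size.
have stE k : size p <= k -> state (mkseq x k) = (st k, mkseq x k) /\
    st k.+1 = if switch (st k).1 (mkseq x k.+1)
              then ((st k).1.+1, mkseq x k.+1) else st k.
  have stepE j : size p <= j -> state (mkseq x j.+1) = step (state (mkseq x j)) (x j).
    by move=> le_pj; rewrite /state mkseqS drop_rcons ?size_mkseq // foldl_rcons.
  move=> le_pk.
  have sk : state (mkseq x k) = (st k, mkseq x k).
    rewrite -(subnKC le_pk); elim: (k - _) => [|i IHi].
      by rewrite addn0 ext /st /state ext drop_size.
    rewrite /st addnS stepE ?leq_addr // IHi mkseqS /=.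
    by case: (st _) => n q /=; case: ifP.
  split=> //; rewrite /st stepE // sk mkseqS.
  by case: (st k) => n q /=; case: ifP.
have inv k : size p <= k ->
  exists j, [/\ (st k).2 = mkseq x j, size p <= j <= k /\ ~ good (mkseq x j),
   forall i, j <= i < k -> st i = st k,
   forall i, j < i <= k -> ~~ switch (st k).1 (mkseq x i) &
   forall n, n < (st k).1 -> U n x].
  move=> le_pk; rewrite -(subnKC le_pk); elim: (k - _) => [|i [j]].
    exists (size p); rewrite addn0 st0 ext; split=> //.
    - by rewrite leqnn.
    - by move=> i; case: leqP => //= /leq_trans le /le; rewrite ltnn.
    - by move=> i; case: leqP => //= lt; rewrite leqNgt lt.
  rewrite addnS; set l := size p + i; have le_pl : size p <= l by exact: leq_addr.
  have [_ ->] := stE l le_pl.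
  move=> [stj [/andP[le_pj le_jl] bj] cst nosw Un].
  case: ifP => [/asboolP[Ul bl]|/negbT nsw].
    exists l.+1; split=> //=.
    - by rewrite leqnn (leq_trans le_pl).
    - by move=> i'; case: ltnP => //= lt /(leq_trans lt); rewrite ltnn.
    - by move=> i'; case: leqP => //= lt; rewrite leqNgt lt.
    - move=> n; rewrite ltnS leq_eqVlt => /orP[/eqP->|/Un//].
      by apply: Ul; exact/extends_mkseq.
  exists j; split=> //.
  - by rewrite le_pj (leq_trans le_jl).
  - move=> i' /andP[le_ji]; rewrite ltnS leq_eqVlt => /orP[/eqP->//|lt].
    by apply: cst; rewrite le_ji.
  - move=> i' /andP[lt_ji]; rewrite leq_eqVlt => /orP[/eqP->//|lt].
    by apply: nosw; rewrite lt_ji.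
apply: contrapT => nA.
(* A counter stuck at [n] would mean following one strategy of [wins_escapes] forever; as [A] fails,
   the run escapes, and its entry into [U n] triggers a switch. *)
have reach n : exists2 k, size p <= k & (st k).1 = n.
  elim: n => [|n [k le_pk stk]]; first by exists (size p); rewrite ?st0.
  apply: contrapT => nex.
  have cst i : st (k + i) = st k.
    elim: i => [|i IHi]; first by rewrite addn0.
    have le_p : size p <= k + i by rewrite (leq_trans le_pk) ?leq_addr.
    rewrite addnS (stE _ le_p).2 IHi; case: ifP => // sw; case: nex.
    exists (k + i).+1; first by rewrite (leq_trans le_p).
    by rewrite (stE _ le_p).2 IHi sw /= stk.
  have [j [qE [/andP[le_pj le_jk] bj] eqst _ _]] := inv k le_pk.
  have cst' i : j <= i -> st i = st k.
    move=> le_ji; have [le_ki|lt_ik] := leqP k i; last by apply: eqst; rewrite le_ji.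
    by rewrite -(subnKC le_ki) cst.
  have [||//|[l [lt_jl Ul _] bl]] := sigP n _ bj x.
  - exact/extends_mkseq.
  - move=> i; rewrite size_mkseq => le_ji ti; rewrite fol ?(leq_trans le_pj) //.
    by rewrite -/(st i) cst' // stk qE.
  rewrite size_mkseq in lt_jl.
  have le_pl := leq_trans le_pj (ltnW lt_jl).
  have [j' [qE' _ _ nosw _]] := inv l le_pl.
  have sl : st l = st k by exact/cst'/ltnW.
  have ejj : j' = j.
    by move: qE'; rewrite sl qE => /(congr1 size); rewrite !size_mkseq.
  have /negP[] : ~~ switch (st l).1 (mkseq x l) by apply: nosw; rewrite ejj lt_jl /=.
  by apply/asboolP; rewrite sl stk.
apply/nA/subA => n; have [k le_pk stk] := reach n.+1.
by have [j [_ _ _ _]] := inv k le_pk; apply; rewrite stk.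
Qed.

End Approximation.

(* A run along which [turn]'s player never wins [A] enlarged by the open sets
   of [open_approximation] avoids those open sets, hence their union, which
   covers [A]. *)
Theorem sigma3_determinacy (A : (nat -> M) -> Prop)
    (U : nat -> nat -> (nat -> M) -> Prop) :
  (forall m n, cyl_open (U m n)) ->
  (forall x, A x <-> exists m, forall n, U m n x) ->
  (exists sigma, forall x, follows turn sigma 0 x -> A x) \/
  (exists sigma, forall x, follows (fun k => ~~ turn k) sigma 0 x -> ~ A x).
Proof.
move=> openU AE; have [[sigma win]|nw] := pselect (wins A [::]).
  by left; exists sigma => x; exact: win.
right.
have [G GP] : {G : ((nat -> M) -> Prop) -> seq M -> (nat -> M) -> Prop |
    forall C p, (forall x, A x -> C x) -> ~ wins C p ->
    [/\ cyl_open (G C p),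
        forall x, extends x p -> (forall n, U (size p) n x) -> G C p x &
        ~ wins (fun x => C x \/ G C p x) p]}.
  have /choice[G P] : forall Cp, exists O : (nat -> M) -> Prop,
      (forall x, A x -> Cp.1 x) -> ~ wins Cp.1 Cp.2 ->
      [/\ cyl_open O,
        forall x, extends x Cp.2 -> (forall n, U (size Cp.2) n x) -> O x &
        ~ wins (fun x => Cp.1 x \/ O x) Cp.2].
    move=> [C p] /=; have [[subC nwC]|nH] :=
      pselect ((forall x, A x -> C x) /\ ~ wins C p); last first.
      by exists (fun _ => True) => subC nwC; case: nH.
    have [|O HO] := open_approximation (openU (size p)) _ nwC; last by exists O.
    by move=> x Ux; apply/subC/AE; exists (size p).
  by exists (fun C p => G (C, p)) => C p; exact: (P (C, p)).
pose grow C p x := C x \/ G C p x.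
pose step (st : ((nat -> M) -> Prop) * seq M) m := (grow st.1 st.2, rcons st.2 m).
(* [pay s] is [A] enlarged by the open sets chosen at the proper prefixes of [s]; the prefix of
   length [m] treats the [m]-th intersection. *)
pose pay s := (foldl step (A, [::]) s).1.
have payS s m : pay (rcons s m) = grow (pay s) s.
  rewrite /pay foldl_rcons /=; congr grow.
  by elim/last_ind: s => // s a IHs; rewrite foldl_rcons /= IHs.
have /choice[tau tauP] : forall s, exists m, ~ turn (size s) ->
    ~ wins (grow (pay s) s) s -> ~ wins (grow (pay s) s) (rcons s m).
  move=> s; have [[/negP ts nws]|nH] :=
    pselect (~ turn (size s) /\ ~ wins (grow (pay s) s) s).
    by have [m nwm] := not_wins_step ts nws; exists m.
  by exists m0 => ts nws; case: nH.
exists tau => x fol Ax.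
have subpay k y : A y -> pay (mkseq x k) y.
  by elim: k => [|k IHk] //; rewrite mkseqS payS => /IHk ?; left.
have nwk k : ~ wins (pay (mkseq x k)) (mkseq x k).
  elim: k => // k IHk; have [_ _ nwG] := GP _ _ (subpay k) IHk.
  rewrite mkseqS payS; have [tk|ntk] := boolP (turn k).
    by move=> /wins_step; rewrite size_mkseq => /(_ tk).
  by rewrite fol //; apply: tauP => //; rewrite size_mkseq; apply/negP.
(* A run in [A] lies in the open set chosen at its prefix of some length [m]. A longer prefix
   already forces that set, so the player wins there trivially, against [nwk]. *)
have [m Um] := (AE x).1 Ax.
have [openG subG _] := GP _ _ (subpay m) (@nwk m).
have Gx : G (pay (mkseq x m)) (mkseq x m) x.
  by apply: subG; [exact/extends_mkseq|rewrite size_mkseq].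
have [N GN] := openP openG Gx.
have mono i : forall y, pay (mkseq x m.+1) y -> pay (mkseq x (m.+1 + i)) y.
  elim: i => [|i IHi] y; first by rewrite addn0.
  by rewrite addnS [in mkseq x (m.+1 + i).+1]mkseqS payS => /IHi ?; left.
apply: (nwk (m.+1 + N)); apply: wins_forced => y exty; apply: mono.
rewrite mkseqS payS; right; apply: GN exty; exact: leq_addl.
Qed.

End Determinacy.

(** * Block subspaces *)

Section BlockSubspaces.
Import GRing.Theory.
Local Open Scope ring_scope.
Variable F : fieldType.
Local Notation E := (vecE F).
Implicit Types (x y : E) (b : nat -> E) (X Y Z W : E -> Prop).

(** A coefficient sequence without trailing zero is exactly the data of a polynomial, so the linear
    structure of polynomials can be borrowed. *)
Definition poly_of x : {poly F} := Polynomial (valP x).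
Definition of_poly (p : {poly F}) : E := exist _ (polyseq p) (valP p).

Lemma coef_poly_of x i : (poly_of x)`_i = coeff x i. Proof. by []. Qed.
Lemma coeff_of_poly p i : coeff (of_poly p) i = p`_i. Proof. by []. Qed.

Lemma coeff_inj x y : coeff x =1 coeff y -> x = y.
Proof.
move=> exy; have e : poly_of x = poly_of y by apply/polyP.
by apply: val_inj; exact: (congr1 (@polyseq F) e).
Qed.

Lemma coeff_minsupp x : vnonzero x -> coeff x (minsupp x) != 0.
Proof.
move=> [i xi]; apply: (@nth_find _ 0 (fun a => a != 0)).
apply/(has_nthP 0); exists i => //.
by rewrite ltnNge; apply: contra xi => /(nth_default 0) e; rewrite /coeff e.
Qed.

Lemma coeff_lt_minsupp x i : (i < minsupp x)%N -> coeff x i = 0.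
Proof. by move=> lt; apply/eqP/negbFE/(before_find 0 lt). Qed.

Lemma coeff_gt_maxsupp x i : (maxsupp x < i)%N -> coeff x i = 0.
Proof.
by rewrite /maxsupp /coeff => lt; apply: nth_default; case: size lt.
Qed.

Lemma minsupp_le_maxsupp x : vnonzero x -> (minsupp x <= maxsupp x)%N.
Proof.
move=> /coeff_minsupp; apply: contraR; rewrite -ltnNge => lt.
by rewrite coeff_gt_maxsupp.
Qed.

(** Agrees with [n < minsupp x] on non-zero vectors but also holds of zero, so a whole subspace can
    satisfy it. *)
Definition vanishes n x := forall i, (i <= n)%N -> coeff x i = 0.

Lemma vanishesP n x : vnonzero x -> vanishes n x <-> (n < minsupp x)%N.
Proof.
move=> nzx; split=> [vx|lt i le]; last exact/coeff_lt_minsupp/(leq_ltn_trans le).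
rewrite ltnNge; apply: contra (coeff_minsupp nzx) => le.
by rewrite vx.
Qed.

Lemma vanishes_leq m n x : (m <= n)%N -> vanishes n x -> vanishes m x.
Proof. by move=> le vx i le_im; apply/vx/(leq_trans le_im). Qed.

Lemma block_lt b i j : block_seq b -> (i < j)%N ->
  (maxsupp (b i) < minsupp (b j))%N.
Proof.
move=> bb; elim: j => // j IHj; rewrite ltnS leq_eqVlt => /orP[/eqP->|/IHj lt].
  exact: (bb j).2.
apply: ltn_trans lt (leq_ltn_trans _ (bb j).2).
exact/minsupp_le_maxsupp/(bb j).1.
Qed.

Lemma block_minsupp b k : block_seq b -> (k <= minsupp (b k))%N.
Proof.
move=> bb; elim: k => // k IHk.
apply: leq_ltn_trans IHk (leq_ltn_trans _ (bb k).2).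
exact/minsupp_le_maxsupp/(bb k).1.
Qed.

Lemma coeff_block b i j : block_seq b -> i != j -> coeff (b j) (minsupp (b i)) = 0.
Proof.
move=> bb; rewrite neq_ltn => /orP[lt|lt].
  apply/coeff_lt_minsupp/(leq_ltn_trans _ (block_lt bb lt)).
  exact/minsupp_le_maxsupp/(bb i).1.
exact/coeff_gt_maxsupp/(block_lt bb lt).
Qed.

Lemma in_span_scale_add b x y a :
  in_span b x -> in_span b y -> in_span b (of_poly (a *: poly_of x + poly_of y)).
Proof.
move=> [n [s xE]] [m [t yE]].
pose pad (n : nat) (s : nat -> F) k := if (k < n)%N then s k else 0.
have padE N (s' : nat -> F) i M : (N <= M)%N ->
    \sum_(k < N) s' k * coeff (b k) i = \sum_(k < M) pad N s' k * coeff (b k) i.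
  move=> le; rewrite (big_ord_widen M (fun k => s' k * coeff (b k) i)) //.
  rewrite big_mkcond; apply: eq_bigr => k _; rewrite /pad.
  by case: ifP => //; rewrite mul0r.
exists (maxn n m), (fun k => a * pad n s k + pad m t k) => i.
rewrite coeff_of_poly coefD coefZ !coef_poly_of xE yE.
rewrite (padE _ _ _ _ (leq_maxl n m)) (padE _ _ _ _ (leq_maxr n m)).
rewrite mulr_sumr -big_split; apply: eq_bigr => k _ /=.
by rewrite mulrDl mulrA.
Qed.

(** Terms with coefficient zero may lie outside [X]; this lets [diagonal_subspace] ignore an initial
    part of the basis. *)
Lemma block_subspace_comb X x n (a : nat -> F) (c : nat -> E) :
  block_subspace X -> (forall k, (k < n)%N -> a k = 0 \/ X (c k)) ->
  (forall i, coeff x i = \sum_(k < n) a k * coeff (c k) i) -> X x.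
Proof.
move=> [b [bb XE]] Xc xE; apply/XE.
have span0 : in_span b (of_poly 0).
  by exists 0%N, (fun _ => 0) => i; rewrite big_ord0 coeff_of_poly coef0.
have poly_ofK p : poly_of (of_poly p) = p by apply/polyP => i.
have -> : x = of_poly (\sum_(k < n) a k *: poly_of (c k)).
  apply: coeff_inj => i; rewrite coeff_of_poly coef_sum xE.
  by apply: eq_bigr => k _; rewrite coefZ.
elim/big_rec: _ => //= k p _ IHp.
have [->|/XE ck] := Xc k (ltn_ord k); first by rewrite scale0r add0r.
by have := in_span_scale_add (a k) ck IHp; rewrite poly_ofK.
Qed.

Lemma in_span_base b k : in_span b (b k).
Proof.
exists k.+1, (fun i => (i == k)%:R) => i.
rewrite big_ord_recr /= eqxx mul1r big1 ?add0r // => j _.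
by rewrite ltn_eqF // mul0r.
Qed.

Lemma block_subspaceT : block_subspace (fun _ : E => True).
Proof.
have cX k i : coeff (of_poly 'X^k) i = (i == k)%:R :> F.
  by rewrite coeff_of_poly coefXn.
exists (fun k => of_poly 'X^k); split.
  move=> k; split; first by exists k; rewrite cX eqxx oner_eq0.
  rewrite {1}/maxsupp /= size_polyXn /=; apply/vanishesP.
    by exists k.+1; rewrite cX eqxx oner_eq0.
  by move=> i le; rewrite cX ltn_eqF.
move=> x; split=> // _; exists (size (poly_of x)), (coeff x) => i.
rewrite -coef_poly_of -[in LHS](coefK (poly_of x)) coef_poly.
under eq_bigr => k _ do rewrite cX.
case: ltnP => [lt|le]; last first.
  by rewrite big1 // => k _; rewrite gtn_eqF ?mulr0 // (leq_trans _ le).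
rewrite (bigD1 (Ordinal lt)) //= eqxx mulr1 big1 ?addr0 // => k ne.
by rewrite [_ == _]eq_sym (negPf ne : (k == i :> nat) = false) mulr0.
Qed.

Lemma block_subspace_tail X n : block_subspace X ->
  exists Z, [/\ block_subspace Z, subset_of Z X & forall x, Z x -> vanishes n x].
Proof.
(* Since [k <= minsupp (b k)], the shift by [n.+1] clears all coordinates up to [n]. *)
move=> bX; have [b [bb XE]] := bX; pose c k := b (k + n.+1)%N.
have Xc k : X (c k) by apply/XE/in_span_base.
exists (in_span c); split.
- by exists c; split=> // k; apply: bb.
- move=> x [m [a xE]]; apply: block_subspace_comb xE => // k _; by right.
- move=> x [m [a xE]] i le; rewrite xE big1 // => k _.
  rewrite coeff_lt_minsupp ?mulr0 // (leq_ltn_trans le) //.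
  by apply: leq_trans (block_minsupp _ bb); rewrite leq_addl.
Qed.

Lemma block_subspace_nonzero X n : block_subspace X ->
  exists x, [/\ X x, vnonzero x & vanishes n x].
Proof.
move=> /(@block_subspace_tail _ n)[Z [[b [bb ZE]] ZX Zn]].
have Zb : Z (b 0) by apply/ZE/in_span_base.
by exists (b 0); split; [exact: ZX|exact: (bb 0).1|exact: Zn].
Qed.

Definition almost_sub X Y := exists n, forall x, X x -> vanishes n x -> Y x.

Lemma sub_almost X Y : subset_of X Y -> almost_sub X Y.
Proof. by move=> XY; exists 0%N => x /XY. Qed.

Lemma almost_sub_trans X Y Z :
  almost_sub X Y -> almost_sub Y Z -> almost_sub X Z.
Proof.
move=> [m XY] [n YZ]; exists (maxn m n) => x Xx vx.
apply: YZ; last exact: vanishes_leq (leq_maxr _ _) vx.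
by apply: XY => //; apply: vanishes_leq (leq_maxl _ _) vx.
Qed.

Lemma almost_sub_meet X Y : block_subspace X -> almost_sub X Y ->
  exists Z, [/\ block_subspace Z, subset_of Z X & subset_of Z Y].
Proof.
move=> bX [n XY]; have [Z [bZ ZX Zn]] := block_subspace_tail n bX.
exists Z; split=> // x Zx; apply: XY; [exact: ZX|exact: Zn].
Qed.

(** Pick [b k] in [Y k] beyond the supports of its predecessors. A vector of the span vanishing up
    to [maxsupp (b n)] has no component on [b k] for [k < n], and the remaining [b k] lie in
    [Y n]. *)
Lemma diagonal_subspace (Y : nat -> E -> Prop) :
  (forall n, block_subspace (Y n)) -> (forall n, subset_of (Y n.+1) (Y n)) ->
  exists Z, [/\ block_subspace Z, subset_of Z (Y 0)
             & forall n, almost_sub Z (Y n)].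
Proof.
move=> bY decY.
have leY m n : (m <= n)%N -> subset_of (Y n) (Y m).
  move=> /subnKC <-; elim: (n - m)%N => [|i IHi] x; first by rewrite addn0.
  by rewrite addnS => /decY/IHi.
have /choice[f fP] : forall s : seq E, exists x,
    [/\ Y (size s) x, vnonzero x & forall y, y \in s -> vanishes (maxsupp y) x].
  move=> s.
  have [x [Yx nzx vx]] := block_subspace_nonzero (\max_(y <- s) maxsupp y) (bY (size s)).
  by exists x; split=> // y ys; apply: vanishes_leq vx; exact: leq_bigmax_seq.
have [b bE] := run_exists f.
have {}fP k : [/\ Y k (b k), vnonzero (b k) &
    forall j, (j < k)%N -> vanishes (maxsupp (b j)) (b k)].
  have [+ nz v] := fP (mkseq b k); rewrite -bE in nz v *; rewrite size_mkseq => Yk.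
  split=> // j lt; apply: v; apply/mapP; exists j => //.
  by rewrite mem_iota.
have bb : block_seq b.
  move=> k; have [_ nz v] := fP k.+1; split; first by have [] := fP k.
  by apply/vanishesP => //; apply: v.
have bZ : block_subspace (in_span b) by exists b; split.
exists (in_span b); split=> //.
  move=> x [n [a xE]]; apply: block_subspace_comb xE => // k _; right.
  by apply: (leY 0%N k) => //; have [] := fP k.
move=> n; exists (maxsupp (b n)) => x [m [a xE]] vx.
apply: (block_subspace_comb (bY n)) (xE).
move=> k lt_km; have [le_nk|lt_kn] := leqP n k.
  by right; apply: leY le_nk _ _; have [] := fP k.
left; apply/eqP; have nzk : vnonzero (b k) by have [] := fP k.
(* This coordinate isolates [a k], as the other basis vectors vanish there. *)
have /eqP : coeff x (minsupp (b k)) = 0.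
  apply: vx; apply: leq_trans (minsupp_le_maxsupp nzk) (ltnW _).
  apply: leq_trans (block_lt bb lt_kn) _; apply: minsupp_le_maxsupp.
  by have [] := fP n.
rewrite xE (bigD1 (Ordinal lt_km)) //= big1 => [|i ne].
  by rewrite addr0 mulf_eq0 (negPf (coeff_minsupp nzk)) orbF.
by rewrite coeff_block ?mulr0 //; rewrite eq_sym.
Qed.

End BlockSubspaces.

(** * From the Kastanas game to the games A and B *)

Definition legal (F : fieldType) (V : vecE F -> Prop)
    (m : vecE F * (vecE F -> Prop)) :=
  [/\ V m.1, vnonzero m.1, block_subspace m.2 & subset_of m.2 V].

(** Schedules the tasks of [fusion]: stage [code i t] treats task [t] for the [i]-th state, which is
    already built by then. *)
Lemma bounding_code (T : countType) : exists code : nat -> T -> nat,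
  (forall i t j t', code i t = code j t' -> i = j /\ t = t') /\
  forall i t, i < code i t.
Proof.
exists (fun i t => CodeSeq.code [:: i; pickle t]); split=> [i t j t'|i t].
  by move/(can_inj CodeSeq.codeK) => [-> /(pcan_inj pickleK)->].
by apply: leq_trans (ltn_expl i (ltnSn 1)) _; rewrite /= leq_pmulr.
Qed.

(* A strategy answering moves (vector, subspace) in kind is presented as an
   automaton: [cur s] is the subspace last played in state [s], and [resp s m]
   is the vector answering [m] with the next state. *)
Section Fusion.
Variable F : countFieldType.
Local Notation E := (vecE F).
Local Notation M := (E * (E -> Prop))%type.
Variables (S : Type) (s0 : S) (cur : S -> E -> Prop) (resp : S -> M -> E * S).
Hypothesis cur_block : forall s, block_subspace (cur s).
Hypothesis resp_legal : forall s m, legal (cur s) m ->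
  legal m.2 ((resp s m).1, cur (resp s m).2).

(* [G] is a countable set of states.  For every state of [G] and vectors [u, v],
   if some subspace makes the strategy answer [u] by [v], one such subspace is
   fixed and the resulting state is put in [G]. *)
Lemma fusion : exists (Y : E -> Prop) (G : S -> Prop),
  [/\ block_subspace Y, G s0, forall s, G s -> almost_sub Y (cur s) &
   forall s u W, G s -> legal (cur s) (u, W) -> subset_of W Y ->
   exists W', [/\ legal (cur s) (u, W'),
     (resp s (u, W')).1 = (resp s (u, W)).1 & G (resp s (u, W')).2]].
Proof.
pose P := ((E -> Prop) * S)%type.
(* [q] pairs a subspace of [Y] with a state reached from [s] by a move with vector [uv.1] answered
   by [uv.2]; the subspace lies below the one played in that state. *)
pose step (Y : E -> Prop) s (uv : E * E) (q : P) :=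
  [/\ block_subspace q.1, subset_of q.1 Y, subset_of q.1 (cur q.2) &
   exists W, legal (cur s) (uv.1, W) /\ resp s (uv.1, W) = (uv.2, q.2)].
pose p0 : P := (cur s0, s0).
have [code [codeI ltn_code]] := bounding_code (E * E)%type.
have /choice[f fP] : forall l : seq P, exists q : P, let Y := (last p0 l).1 in
    (l = [::] -> q = p0) /\
    (block_subspace Y -> subset_of Y (cur s0) ->
     [/\ block_subspace q.1, subset_of q.1 Y, subset_of q.1 (cur q.2) &
      forall i uv, i < size l -> size l = code i uv ->
      (exists q', step Y (nth p0 l i).2 uv q') -> step Y (nth p0 l i).2 uv q]).
  move=> l /=; have [[q [i [uv [lt_i sz st]]]]|nex] := pselect (exists q i uv,
      [/\ i < size l, size l = code i uv &
       step (last p0 l).1 (nth p0 l i).2 uv q]).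
    exists q; split=> [l0|_ _]; first by rewrite l0 in lt_i.
    have [bq qY qc _] := st; split=> // i' uv' _.
    by rewrite sz => /codeI[<- <-].
  (* An unrealizable task leaves the subspace unchanged, with [s0] as a harmless repeated state. *)
  exists ((last p0 l).1, s0); split=> [->//|bY Ys].
  split=> // i uv lt_i sz [q st]; case: nex.
  by exists q, i, uv.
have [p pE] := run_exists f.
have p_0 : p 0 = p0 by rewrite pE; apply: (fP _).1.
have lastp n : last p0 (mkseq p n.+1) = p n by rewrite mkseqS last_rcons.
have pY n : block_subspace (p n).1 /\ subset_of (p n).1 (cur s0).
  elim: n => [|n [IHb IHs]]; first by rewrite p_0; split=> //; exact: cur_block.
  have [_] := fP (mkseq p n.+1); rewrite -pE lastp => /(_ IHb IHs)[b sub _ _].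
  by split=> // x /sub/IHs.
have pS n : subset_of (p n.+1).1 (p n).1 /\ subset_of (p n.+1).1 (cur (p n.+1).2).
  have [bn sn] := pY n.
  by have [_] := fP (mkseq p n.+1); rewrite -pE lastp => /(_ bn sn)[_ sub sub' _].
have [Y [bY YY0 Yp]] :=
  diagonal_subspace (fun n => (pY n).1) (fun n => (pS n).1).
exists Y, (fun s => exists n, s = (p n).2); split=> //.
- by exists 0; rewrite p_0.
- move=> _ [n ->]; apply: almost_sub_trans (Yp n) (sub_almost _).
  by case: n => [|n]; [rewrite p_0 => x|exact: (pS n).2].
move=> _ u W [i ->] leg WY; set uv : E * E := (u, (resp (p i).2 (u, W)).1).
have := ltn_code i uv; case codeE: (code i uv) => [//|n] lt_in.
have [bn sn] := pY n.
have [_] := fP (mkseq p n.+1); rewrite -pE lastp => /(_ bn sn)[_ _ _].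
rewrite size_mkseq => /(_ i uv lt_in (esym codeE)); rewrite nth_mkseq //.
have [_ _ /= bW Wc] := leg; have [rv rnz rb rW] := resp_legal leg.
case.
  (* The task of stage [n.+1] is realizable: the answered subspace lies in [W], hence in [Y], hence
     almost in [(p n).1], and [Z] is a common refinement. *)
  have [|Z [bZ Zr Zp]] := @almost_sub_meet _ (cur (resp (p i).2 (u, W)).2) (p n).1 rb.
    by apply: almost_sub_trans (Yp n); apply: sub_almost => x /rW/WY.
  exists (Z, (resp (p i).2 (u, W)).2); split=> //.
  by exists W; split=> //; exact: surjective_pairing.
move=> _ _ _ [W' [leg' respE]]; exists W'; rewrite respE; split=> //.
by exists n.+1.
Qed.

Variables (B : (nat -> E) -> Prop).
Hypothesis win : forall (s : nat -> S) (u v : nat -> E) (W : nat -> E -> Prop),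
  s 0 = s0 -> (forall k, legal (cur (s k)) (u k, W k)) ->
  (forall k, resp (s k) (u k, W k) = (v k, s k.+1)) -> B (interleave u v).

(** II keeps a state of [G]. His integer puts [x] inside [cur s], and [Z] is shrunk to some [W]
    inside [cur s]. Replacing [W] by the [W'] of [fusion] keeps the answer, which lies in [W] and so
    in [Z], and leads back into [G]. *)
Lemma II_wins_A_of_responder : exists Y, block_subspace Y /\ II_wins_A Y B.
Proof.
have [Y [G [bY G0 YG fus]]] := fusion.
exists Y; split=> //.
have /choice[nf nfP] : forall s, exists n, G s ->
    forall x, Y x -> vanishes n x -> cur s x.
  move=> s; have [/YG[n Yn]|nG] := pselect (G s); first by exists n.
  by exists 0.
have /choice[step stepP] : forall sm : S * M, exists r : E * S,
    G sm.1 -> I_legalA Y sm.2.1 sm.2.2 (nf sm.1) ->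
    [/\ sm.2.2 r.1, vnonzero r.1, G r.2 &
     exists W, legal (cur sm.1) (sm.2.1, W) /\ resp sm.1 (sm.2.1, W) = r].
  move=> [s [x Z]] /=.
  have [[Gs [[Yx [nzx vx]] [bZ ZY]]]|nH] :=
    pselect (G s /\ I_legalA Y x Z (nf s)); last first.
    by exists ((resp s (x, Z)).1, s) => Gs leg; case: nH.
  have [|W [bW WZ Wc]] := @almost_sub_meet _ Z (cur s) bZ.
    by apply: almost_sub_trans (YG s Gs); exact: sub_almost.
  have legW : legal (cur s) (x, W).
    by split=> //; apply: nfP => //; exact/vanishesP.
  have [|W' [leg' respE Gr]] := fus s x W Gs legW; first by move=> z /WZ/ZY.
  exists (resp s (x, W')) => _ _; have [rv rnz _ _] := resp_legal legW.
  by rewrite respE; split=> //; [exact: WZ|exists W'].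
(* [d] only fills the vector slot for the empty history, where just the integer counts. *)
have [d _] := block_subspace_nonzero 0 bY.
pose run l := foldl (fun (st : E * S) m => step (st.2, m)) (d, s0) l.
exists (fun l => ((run l).1, nf (run l).2)) => xs Zs n y.
have runS k : run (histA xs Zs k.+1) = step ((run (histA xs Zs k)).2, (xs k, Zs k)).
  by rewrite /run /histA -/(mkseq _ _) mkseqS foldl_rcons.
have Grun k : (forall j, j < k -> I_legalA Y (xs j) (Zs j) (n j)) ->
    G (run (histA xs Zs k)).2.
  elim: k => [|k IHk] leg //; rewrite runS.
  have /IHk Gk : forall j, j < k -> I_legalA Y (xs j) (Zs j) (n j).
    by move=> j /ltnW; exact: leg.
  by have [] := stepP (_, (xs k, Zs k)) Gk (leg k (ltnSn k)).
split=> [k leg|leg].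
  have Gk := Grun k (fun j lt => leg j (ltnW lt)).
  have [] := stepP (_, (xs k, Zs k)) Gk (leg k (leqnn k)).
  by rewrite -runS.
have ex k : exists W, legal (cur (run (histA xs Zs k)).2) (xs k, W) /\
    resp (run (histA xs Zs k)).2 (xs k, W) = run (histA xs Zs k.+1).
  have Gk := Grun k (fun j _ => leg j).
  by have [] := stepP (_, (xs k, Zs k)) Gk (leg k); rewrite -runS.
have /choice[W WP] := ex.
apply: (win (s := fun k => (run (histA xs Zs k)).2) (W := W)) => // k.
  exact: (WP k).1.
by rewrite (WP k).2; exact: surjective_pairing.
Qed.

End Fusion.

(** I of B acts as II of A facing a fictitious first vector [d], chosen to respect the opening
    integer of [sigma]; each [ys j] then serves as vector number [j.+1]. The shift of the payoff
    erases [d]. *)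
Lemma I_wins_B_of_II_wins_A (F : fieldType) (V : vecE F -> Prop) A :
  block_subspace V -> II_wins_A V (fun z => A (fun n => z n.+1)) ->
  I_wins_B V A.
Proof.
move=> bV [sigma winA].
have [d [Vd nzd vd]] := block_subspace_nonzero (sigma [::]).2 bV.
exists (fun Zs ys => sigma (zip (d :: ys) Zs)) => ys Zs x n.
pose xs k := if k is j.+1 then ys j else d.
have histE k : zip (d :: mkseq ys k) (mkseq Zs k.+1) = histA xs Zs k.+1.
  have -> : d :: mkseq ys k = mkseq xs k.+1.
    by rewrite /mkseq /= -[1]addn0 iotaDl -map_comp.
  by rewrite /histA /mkseq zip_map.
have [leg win] := winA xs Zs.
have legalI k : (forall j, j <= k -> II_legalZ V (Zs j)) ->
    (forall j, j < k -> tail_part V (n j) (ys j)) ->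
    forall j, j <= k -> I_legalA V (xs j) (Zs j) (sigma (histA xs Zs j)).2.
  move=> lZ ly j le_jk; split; last exact: lZ.
  case: j le_jk => [|j] lt_jk; last by rewrite -histE; exact: ly.
  by split=> //; split=> //; exact/vanishesP.
split=> [k lZ ly|lall].
  by rewrite /x histE; apply: leg; exact: legalI.
have -> : interleave x ys =
    fun m => interleave xs (fun k => (sigma (histA xs Zs k.+1)).1) m.+1.
  apply: funext => m; rewrite /interleave /= uphalf_half.
  by case: odd => //=; rewrite /x histE.
apply: win => k; apply: (@legalI k) => // j _; first exact: (lall j).1.
exact: (lall j).2.
Qed.

(** * The Kastanas game as a game without rules *)

Section Kastanas.
Variable F : countFieldType.
Local Notation E := (vecE F).
Local Notation M := (E * (E -> Prop))%type.

Lemma legal_fallback : exists fb : (E -> Prop) -> E,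
  forall V, block_subspace V -> legal V (fb V, V).
Proof.
have /choice[fb fbP] : forall V : E -> Prop, exists x, block_subspace V ->
    legal V (x, V).
  move=> V; have [bV|nb] := pselect (block_subspace V).
    by have [x [Vx nzx _]] := block_subspace_nonzero 0 bV; exists x => _; split=> // y.
  by exists (of_poly 0%R).
by exists fb.
Qed.

Definition fallback : (E -> Prop) -> E := projT1 (cid legal_fallback).

(** Illegal moves are read as a default legal one, so every sequence of moves is a run and
    [sigma3_determinacy] applies. *)
Definition legalize (m m' : M) : M :=
  if `[<legal m.2 m'>] then m' else (fallback m.2, m.2).

Definition current (h : seq M) : M :=
  foldl legalize (of_poly 0%R, fun=> True) h.

Lemma current_rcons h m : current (rcons h m) = legalize (current h) m.
Proof. exact: foldl_rcons. Qed.

Lemma legalize_legal m m' : block_subspace m.2 -> legal m.2 (legalize m m').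
Proof.
move=> bm; rewrite /legalize; case: asboolP => // _.
exact: projT2 (cid legal_fallback) _ bm.
Qed.

Lemma legalize_id m m' : legal m.2 m' -> legalize m m' = m'.
Proof. by move=> /asboolT lm; rewrite /legalize lm. Qed.

Lemma block_current h : block_subspace (current h).2.
Proof.
elim/last_ind: h => [|h m IHh]; first exact: block_subspaceT.
by rewrite current_rcons; have [] := legalize_legal m IHh.
Qed.

(** The automaton has histories as states, each extended by a move and the reply of [sigma].
    Starting from [h0] accommodates an opening move. *)
Lemma II_wins_A_of_strategy (sigma : seq M -> M) h0 (B : (nat -> E) -> Prop) :
  (forall x, extends x h0 ->
    (forall k, x (size h0 + k.*2.+1) = sigma (mkseq x (size h0 + k.*2.+1))) ->
    B (fun n => (current (mkseq x (size h0 + n.+1))).1)) ->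
  exists Y, block_subspace Y /\ II_wins_A Y B.
Proof.
move=> win.
pose resp (s : seq M) m :=
  let s2 := rcons (rcons s m) (sigma (rcons s m)) in ((current s2).1, s2).
apply: (II_wins_A_of_responder (s0 := h0) (cur := fun s => (current s).2)
  (resp := resp)).
- exact: block_current.
- move=> s m leg.
  have cm : current (rcons s m) = m by rewrite current_rcons legalize_id.
  have := legalize_legal (sigma (rcons s m)) (block_current (rcons s m)).
  by rewrite -current_rcons {1}cm /=; case: (current _).
move=> s u v W s_0 leg respE.
have sS k : s k.+1 = rcons (rcons (s k) (u k, W k)) (sigma (rcons (s k) (u k, W k))).
  by have [_ <-] := respE k.
have sz k : size (s k) = size h0 + k.*2.
  elim: k => [|k IHk]; first by rewrite s_0 addn0.
  by rewrite sS !size_rcons IHk doubleS !addnS.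
pose m0 : M := (of_poly 0%R, fun=> True).
have nth_s j k n : j <= k -> n < size (s j) -> nth m0 (s k) n = nth m0 (s j) n.
  move=> /subnKC <-; elim: (k - j) => [|i IHi] lt; first by rewrite addn0.
  have lt' : n < size (s (j + i)).
    by apply: leq_trans lt _; rewrite !sz leq_add2l leq_double leq_addr.
  by rewrite addnS sS !nth_rcons size_rcons ltnS lt' (ltnW lt') IHi.
(* The histories [s k] are nested prefixes of one run; [s n.+1] is long enough to contain index
   [n]. *)
pose x n := nth m0 (s n.+1) n.
have xs k : mkseq x (size (s k)) = s k.
  apply: (@eq_from_nth _ m0) => [|n]; rewrite size_mkseq // => lt.
  rewrite nth_mkseq // /x -(nth_s n.+1 (maxn n.+1 k)) ?leq_maxl //.
    by rewrite (nth_s k) // leq_maxr.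
  rewrite sz doubleS; apply: leq_trans (leq_addl _ _).
  by rewrite -addnn ltnS ltnW // ltnS leq_addr.
have xk k : mkseq x (size h0 + k.*2.+1) = rcons (s k) (u k, W k) /\
    x (size h0 + k.*2.+1) = sigma (rcons (s k) (u k, W k)).
  have := xs k.+1; rewrite sS !size_rcons mkseqS sz -addnS => e.
  by have [] := rcons_inj e.
have -> : interleave u v = fun n => (current (mkseq x (size h0 + n.+1))).1.
  apply: funext => n; rewrite -[n in RHS]odd_double_half /interleave.
  case: odd => /=; last by rewrite (xk _).1 current_rcons legalize_id.
  rewrite add1n -doubleS -sz xs.
  by have [<- _] := respE n./2; rewrite sS.
apply: win => [|k]; last by rewrite (xk k).1 (xk k).2.
by rewrite /extends -[in mkseq _ _]s_0 xs.
Qed.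

(** Starting at [n.+2] drops the vector of the first move. *)
Definition outcome (x : nat -> M) n := (current (mkseq x n.+2)).1.

Lemma outcome_open U : is_open U -> cyl_open (fun x : nat -> M => U (outcome x)).
Proof.
move=> openU x /openU[N UN]; exists N.+1 => y eyx; apply: UN => i lt_iN.
by rewrite /outcome (eq_mkseq_leq _ eyx).
Qed.

(** I owns the odd positions and only replies, so [h0] is empty and the dropped first vector is the
    one erased in passing to B. II owns the even ones, and his opening move becomes [h0]. *)
Lemma kastanas_dichotomy (A : (nat -> E) -> Prop) :
  (exists sigma, forall x, follows odd sigma 0 x -> A (outcome x)) \/
  (exists sigma, forall x, follows (fun k => ~~ odd k) sigma 0 x ->
     ~ A (outcome x)) ->
  exists X, block_subspace X /\ (II_wins_A X (fun o => ~ A o) \/ I_wins_B X A).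
Proof.
case=> -[sigma win].
  have [|X [bX winX]] :=
    @II_wins_A_of_strategy sigma [::] (fun z => A (fun n => z n.+1)).
    move=> x _ fol; apply: win => k _ ok.
    have -> : k = k./2.*2.+1 by rewrite -[LHS]odd_double_half ok.
    exact: fol.
  by exists X; split=> //; right; exact: I_wins_B_of_II_wins_A.
have [|X [bX winX]] :=
  @II_wins_A_of_strategy sigma [:: sigma [::]] (fun z => ~ A z).
  move=> x [x0] fol; apply: win => -[|k] // _ ok.
  have {}ok : odd k by rewrite -[odd k]negbK.
  have -> : k = k./2.*2.+1 by rewrite -[LHS]odd_double_half ok.
  exact: fol.
by exists X; split=> //; left.
Qed.

End Kastanas.

Theorem theorem1 (F : countFieldType) (A : (nat -> vecE F) -> Prop) :
  F_sigma_delta A \/ G_delta_sigma A ->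
  exists X : vecE F -> Prop, block_subspace X /\
    (II_wins_A X (fun o => ~ A o) \/ I_wins_B X A).
Proof.
pose m0 : vecE F * (vecE F -> Prop) := (of_poly 0%R, fun=> True).
move=> AE; apply: kastanas_dichotomy; case: AE => [[C [closedC AE]]|[U [openU AE]]].
  (* Here the complement of [A] is the union of countable intersections of open sets, so determinacy
     is applied from the side of II. *)
  have [] := @sigma3_determinacy _ m0 (fun k => ~~ odd k)
    (fun x => ~ A (outcome x)) (fun m n x => ~ C m n (outcome x)).
  - by move=> m n; exact: (outcome_open (closedC m n)).
  - move=> x; rewrite AE -existsNP; split=> -[m Cm]; exists m.
      by apply/forallNP.
    by apply/forallNP.
  - by right.
  move=> [sigma win]; left; exists sigma => x fol; apply: contrapT.
  by apply: win => k le0 ek; apply: fol => //; apply/negPn.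
have [] := @sigma3_determinacy _ m0 odd (fun x => A (outcome x))
  (fun m n x => U m n (outcome x)); last 2 first.
- by left.
- by right.
- by move=> m n; exact: outcome_open.
- by move=> x; exact: AE.
Qed.
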